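(* Let $K$ be a field, $S=K[x_1,\ldots,x_n]$ and let $I\subset S$ be a strongly stable monomial ideal. Then \[ \operatorname{sat}(I)=\max\{\ell\ge 0:\ x_n^{\ell}\mid u\ \text{ for some } u\in G(I)\}. \]
   Context: $\mathfrak m=(x_1,\ldots,x_n)$. For a monomial ideal $I$, $G(I)$ is its unique minimal set of monomial generators. A monomial ideal $I$ is strongly stable if for all $u\in G(I)$ and all $i<j$ with $x_j\mid u$ one has $x_iu/x_j\in I$ (equivalently, the same for all monomials $u\in I$). For a graded ideal $I\subset S$, the saturation number is $\operatorname{sat}(I)=\min\{k\ge 0: I:\mathfrak m^k=I:\mathfrak m^{k+1}\}$. The maximum of the empty set is read as $0$ (relevant only for $I=0$). *)

(* Defs.v *)
From Stdlib Require Import Classical.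
From mathcomp Require Import all_boot all_order all_algebra.
From mathcomp Require Export mpoly.

Set Implicit Arguments.
Unset Strict Implicit.
Unset Printing Implicit Defensive.

Import GRing.Theory.

Local Open Scope ring_scope.

(* Ideals are [Prop]-valued predicates, because the boolean ideals of
   [ring_quotient] have decidable membership and exclude the unit ideal. *)

Section Ideals.

Variable R : comNzRingType.
Implicit Types (I J A : R -> Prop).

Definition subset_of (T : Type) (A B : T -> Prop) := forall x, A x -> B x.

Definition same_set (T : Type) (A B : T -> Prop) := forall x, A x <-> B x.

Record is_ideal I : Prop := IsIdeal {
  ideal0 : I 0;
  idealD : forall f g, I f -> I g -> I (f + g);
  idealMl : forall f g, I g -> I (f * g)
}.

Definition ideal_gen A : R -> Prop :=
  fun f => forall J, is_ideal J -> subset_of A J -> J f.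

Definition ideal_mul I J : R -> Prop :=
  ideal_gen (fun h => exists f g, [/\ I f, J g & h = f * g]).

Fixpoint ideal_exp I (k : nat) : R -> Prop :=
  if k is k'.+1 then ideal_mul I (ideal_exp I k') else fun=> True.

Definition ideal_colon I J : R -> Prop :=
  fun f => forall g, J g -> I (f * g).

End Ideals.

Section NatExtrema.

Implicit Types (A : nat -> Prop) (m : nat).

Definition is_min A m := A m /\ forall l, A l -> (m <= l)%N.

(* The maximum of the empty set is 0. *)
Definition is_max A m :=
  (A m /\ forall l, A l -> (l <= m)%N) \/ ((forall l, ~ A l) /\ m = 0%N).

End NatExtrema.

Section MonomialIdeals.

Variables (K : fieldType) (n : nat).
Implicit Types (I : {mpoly K[n]} -> Prop) (G M : 'X_{1..n} -> Prop).

Definition max_ideal : {mpoly K[n]} -> Prop :=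
  ideal_gen (fun f => exists i : 'I_n, f = 'X_i).

(* Monomials are represented by their exponents, so that [(u <= v)%MM] is
   divisibility of monomials. *)
Definition mono_gen M : {mpoly K[n]} -> Prop :=
  ideal_gen (fun f => exists2 m, M m & f = 'X_[m]).

Definition monomial_ideal I := exists M, same_set I (mono_gen M).

Definition minimal_gens I G :=
  same_set I (mono_gen G) /\
  forall G', same_set I (mono_gen G') -> subset_of G' G -> subset_of G G'.

(* G(I); see [mingensP] and [minimal_gens_unique]. *)
Definition mingens I : 'X_{1..n} -> Prop :=
  fun m => exists2 G, minimal_gens I G & G m.

Definition strongly_stable I :=
  forall u, mingens I u -> forall i j : 'I_n,
    (i < j)%N -> (U_(j) <= u)%MM -> I 'X_[U_(i) + u - U_(j)].

Definition is_sat I : nat -> Prop :=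
  is_min (fun k => same_set (ideal_colon I (ideal_exp max_ideal k))
                            (ideal_colon I (ideal_exp max_ideal k.+1))).

Lemma ideal_gen_ideal (R : comNzRingType) (A : R -> Prop) :
  is_ideal (ideal_gen A).
Proof.
split=> [J HJ _|f g Hf Hg J HJ HA|f g Hg J HJ HA]; first exact: ideal0.
- by apply: idealD => //; [apply: Hf | apply: Hg].
- by apply: idealMl => //; apply: Hg.
Qed.

Lemma mono_gen_mem M m : M m -> mono_gen M 'X_[m].
Proof. by move=> Mm J _; apply; exists m. Qed.

Lemma mono_gen_msupp M f m :
  mono_gen M f -> m \in msupp f -> exists2 g, M g & (g <= m)%MM.
Proof.
pose J (f : {mpoly K[n]}) :=
  forall m, m \in msupp f -> exists2 g, M g & (g <= m)%MM.
move=> Hf; move: m; apply: (Hf J); first split.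
- by move=> m; rewrite -mpolyC0 msupp0.
- move=> p q Hp Hq m /msuppD_le; rewrite mem_cat.
  by case/orP; [apply: Hp | apply: Hq].
- move=> p q Hq m /msuppM_le /allpairsP[[m1 m2] /= [_ Hm2 ->]].
  have [g Mg le_g] := Hq _ Hm2; exists g => //.
  exact: (lepm_trans le_g (lem_addl _ _)).
- move=> _ [m Mm ->] k; rewrite msuppX inE => /eqP ->.
  by exists m => //; apply: lepm_refl.
Qed.

Lemma mono_genX M m : mono_gen M 'X_[m] <-> exists2 g, M g & (g <= m)%MM.
Proof.
split=> [H|[g Mg le_gm]].
  by apply: (mono_gen_msupp H); rewrite msuppX inE.
rewrite -(submK le_gm) mpolyXD.
by apply: (idealMl (ideal_gen_ideal _)); apply: mono_gen_mem.
Qed.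

Lemma lepm_anti (m1 m2 : 'X_{1..n}) : (m1 <= m2)%MM -> (m2 <= m1)%MM -> m1 = m2.
Proof.
move=> /mnm_lepP le12 /mnm_lepP le21; apply/mnmP => i.
by apply/eqP; rewrite eqn_leq le12 le21.
Qed.

Definition primitive M : 'X_{1..n} -> Prop :=
  fun m => M m /\ forall g, M g -> (g <= m)%MM -> g = m.

Lemma primitive_below M m : M m -> exists2 g, primitive M g & (g <= m)%MM.
Proof.
have [k] := ubnP (mdeg m); elim: k m => // k IHk m lt_m Mm.
case: (classic (primitive M m)) => [Pm|nPm]; first by exists m => //; apply: lepm_refl.
case: (classic (exists g, [/\ M g, (g <= m)%MM & g <> m])) => [|no_g].
  move=> [g [Mg le_gm ne_gm]]; have lt_g : (mdeg g < k)%N.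
    rewrite -ltnS; apply: leq_ltn_trans lt_m.
    have Em := submK le_gm; have := mdegD (m - g)%MM g; rewrite Em => ->.
    rewrite -add1n leq_add2r lt0n mdeg_eq0.
    apply/eqP => E0; apply: ne_gm.
    by rewrite -Em E0 add0m.
  have [h Ph le_hg] := IHk _ lt_g Mg.
  by exists h => //; apply: lepm_trans le_hg le_gm.
case: nPm; split=> // g Mg le_gm.
by apply: NNPP => ne_gm; apply: no_g; exists g.
Qed.

Lemma mono_gen_primitive M : same_set (mono_gen M) (mono_gen (primitive M)).
Proof.
move=> f; split=> Hf J HJ sJ; apply: Hf => // _ [m Mm ->].
  have [g Pg le_gm] := primitive_below Mm.
  rewrite -(submK le_gm) mpolyXD; apply: (idealMl HJ).
  by apply: sJ; exists g.
by apply: sJ; exists m => //; case: Mm.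
Qed.

Lemma primitive_minimal I M :
  same_set I (mono_gen M) -> minimal_gens I (primitive M).
Proof.
move=> HI; split=> [f|G' HG' sG' m Pm].
  exact: iff_trans (HI f) (mono_gen_primitive M f).
have /HI/HG'/mono_genX[g G'g le_gm] : mono_gen M 'X_[m].
  by apply: mono_gen_mem; case: Pm.
by have [Mg _] := sG' _ G'g; rewrite -((proj2 Pm) g Mg le_gm).
Qed.

Lemma minimal_gens_primitive I G :
  minimal_gens I G -> subset_of G (primitive G).
Proof.
move=> [HI minG]; apply: minG => [f|m []//].
exact: iff_trans (HI f) (mono_gen_primitive G f).
Qed.

Lemma minimal_gens_unique I G H :
  minimal_gens I G -> minimal_gens I H -> same_set G H.
Proof.
suff sub A B : minimal_gens I A -> minimal_gens I B -> subset_of A B.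
  by move=> mG mH m; split; apply: sub.
move=> mA mB m Am.
have /(proj1 mA)/(proj1 mB)/mono_genX[h Bh le_hm] := mono_gen_mem Am.
have /(proj1 mB)/(proj1 mA)/mono_genX[g Ag le_gh] := mono_gen_mem Bh.
have [_ primm] := minimal_gens_primitive mA Am.
have Eg := primm g Ag (lepm_trans le_gh le_hm).
by rewrite Eg in le_gh; rewrite (lepm_anti le_gh le_hm).
Qed.

Lemma mingensP I : monomial_ideal I -> minimal_gens I (mingens I).
Proof.
move=> [M /primitive_minimal]; set P := primitive M => mP.
have E : same_set P (mingens I).
  move=> m; split=> [Pm|[G mG Gm]]; first by exists P.
  exact/(minimal_gens_unique mG mP).
have EG : same_set (mono_gen P) (mono_gen (mingens I)).
  by move=> f; split=> Hf J HJ sJ; apply: Hf => // _ [m /E Em ->];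
     apply: sJ; exists m.
split=> [f|G' HG' sG' m /E Pm]; first exact: iff_trans ((proj1 mP) f) (EG f).
by apply: (proj2 mP) Pm => // k /sG' /E.
Qed.

End MonomialIdeals.

(* Main.v *)
(** For a strongly stable ideal [I], any factor [x_n] of a monomial of [I] may be
    replaced by another variable, so that [I : m^k = I : x_n^k] for all [k].
    If [s] bounds the exponents of [x_n] in [G(I)], a generator dividing
    [w x_n^(s+1)] already divides [w x_n^s], so the chain of colons stops at [s].
    If [u] in [G(I)] has [x_n]-exponent [s > k], then [u / x_n^(k+1)] lies in
    [I : x_n^(k+1)] and, by minimality of [u], not in [I : x_n^k]. *)

Require Import Defs.
From Stdlib Require Import Classical.
From mathcomp Require Import all_boot all_order all_algebra.
From mathcomp Require Import zify.

Local Open Scope ring_scope.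

Lemma is_max_exists (A : nat -> Prop) (B : nat) :
  (forall l, A l -> (l <= B)%N) -> exists m, is_max A m.
Proof.
elim: B => [|B IHB] leA.
  exists 0%N; case: (classic (A 0%N)) => [A0|nA0]; [by left | right].
  split=> // l Al; apply: nA0.
  by move: Al (leA _ Al); rewrite leqn0 => Al /eqP El; rewrite El in Al.
case: (classic (A B.+1)) => [AB|nAB]; first by exists B.+1; left.
apply: IHB => l Al; have := leA _ Al.
by rewrite leq_eqVlt => /orP[/eqP El|//]; case: nAB; rewrite -El.
Qed.

(** Used in Dickson's lemma to merge the bounds found on finitely many slices into one. *)
Lemma uniform_bound (Q : nat -> nat -> Prop) (N : nat) :
  (forall j b c, (b <= c)%N -> Q j b -> Q j c) -> (forall j, exists b, Q j b) ->
  exists B, forall j, (j < N)%N -> Q j B.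
Proof.
move=> monoQ exQ; elim: N => [|N [B HB]]; first by exists 0%N.
have [b Qb] := exQ N; exists (maxn B b) => j.
rewrite ltnS leq_eqVlt => /orP[/eqP->|/HB].
  by apply: monoQ Qb; apply: leq_maxr.
by apply: monoQ; apply: leq_maxl.
Qed.

(* Dickson's lemma, for the preorder comparing only the first [k] exponents:
   instead of exhibiting finitely many elements of [P] lying below all others,
   it says that they can be chosen with any given statistic [h] bounded. *)
Lemma dickson (n k : nat) (P : 'X_{1..n} -> Prop) (h : 'X_{1..n} -> nat) :
  exists B, forall m, P m -> exists g,
    [/\ P g, forall i : 'I_n, (i < k)%N -> (g i <= m i)%N & (h g <= B)%N].
Proof.
elim: k P h => [|k IHk] P h.
  case: (classic (exists g, P g)) => [[g Pg]|noP]; first by exists (h g); exists g.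
  by exists 0%N => m Pm; case: noP; exists m.
have [lt_kn|le_nk] := ltnP k n; last first.
  have [B HB] := IHk P h; exists B => m /HB[g [Pg le_gm hg]].
  by exists g; split=> // i _; apply: le_gm; apply: leq_trans le_nk.
pose o := Ordinal lt_kn.
(* The statistic includes the new exponent [g o], so an element chosen for [m] also lies below [m]
   at [o] once [B0 <= m o]. The remaining [m] fall into the finitely many slices [m o = j] with
   [j < B0]; within a slice the new exponents agree. *)
have [B0 HB0] := IHk P (fun g => maxn (h g) (g o)).
pose Q j b := forall m, P m /\ m o = j -> exists g,
  [/\ P g /\ g o = j, forall i : 'I_n, (i < k)%N -> (g i <= m i)%N
    & (h g <= b)%N].
have [B1 HB1] : exists B, forall j, (j < B0)%N -> Q j B.
  apply: uniform_bound => [j b c le_bc Qjb m /Qjb[g [Pg le_gm hg]]|j].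
    by exists g; split=> //; apply: leq_trans le_bc.
  exact: (IHk (fun m => P m /\ m o = j) h).
exists (maxn B0 B1) => m Pm.
have split_ord (i : 'I_n) : (i < k.+1)%N -> i = o \/ (i < k)%N.
  by rewrite ltnS leq_eqVlt => /orP[/eqP Ei|]; [left; apply: val_inj | right].
have [lt_m|le_m] := ltnP (m o) B0.
  have [g [[Pg Eg] le_gm hg]] := HB1 _ lt_m m (conj Pm erefl).
  exists g; split=> // [i /split_ord[->|/le_gm //]|]; first by rewrite Eg.
  by rewrite leq_max hg orbT.
have [g [Pg le_gm]] := HB0 m Pm; rewrite geq_max => /andP[hg go].
exists g; split=> // [i /split_ord[->|/le_gm //]|].
  exact: leq_trans le_m.
by rewrite leq_max hg.
Qed.

Lemma lemMn1 (n : nat) (i : 'I_n) (l : nat) (m : 'X_{1..n}) :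
  (U_(i) *+ l <= m)%MM = (l <= m i)%N.
Proof.
apply/mnm_lepP/idP => [/(_ i)|le_lm j]; first by rewrite mulmnE mnm1E eqxx mul1n.
by rewrite mulmnE mnm1E; case: eqP => [<-|]; rewrite ?mul1n ?mul0n.
Qed.

Section MonomialIdeal.

Variables (K : fieldType) (n : nat).
Implicit Types (M : 'X_{1..n} -> Prop) (f g : {mpoly K[n]}).

Lemma mono_gen_msuppP M f :
  mono_gen M f <-> forall m, m \in msupp f -> mono_gen M ('X_[m] : {mpoly K[n]}).
Proof.
split=> [Mf m /(mono_gen_msupp Mf)/mono_genX //|suppM].
have idM : is_ideal (mono_gen M : {mpoly K[n]} -> Prop) by apply: ideal_gen_ideal.
rewrite [f]mpolyE big_seq; apply: (big_ind (mono_gen M)).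
- exact: ideal0.
- exact: idealD.
- by move=> m /suppM Mm; rewrite -mul_mpolyC; exact: (idealMl idM).
Qed.

Lemma mono_genDr M (m k : 'X_{1..n}) :
  mono_gen M ('X_[m] : {mpoly K[n]}) -> mono_gen M ('X_[m + k] : {mpoly K[n]}).
Proof.
by move=> Mm; rewrite addmC mpolyXD; apply: (idealMl (ideal_gen_ideal _)).
Qed.

(** The polynomials all of whose monomials have degree at least [k] form an ideal, and degrees add
    under products. *)
Lemma ideal_exp_msupp (k : nat) g :
  ideal_exp (@max_ideal K n) k g -> forall m, m \in msupp g -> (k <= mdeg m)%N.
Proof.
pose D k f := forall m, m \in msupp f -> (k <= mdeg m)%N.
have idD j : is_ideal (D j).
  split=> [m|p q Dp Dq m /msuppD_le|p q Dq m /msuppM_le].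
  - by rewrite -mpolyC0 msupp0.
  - by rewrite mem_cat => /orP[/Dp|/Dq].
  case/allpairsP=> -[m1 m2] /= [_ /Dq Hm2 ->].
  by rewrite mdegD (leq_trans Hm2) ?leq_addl.
have max1 p : max_ideal p -> D 1%N p.
  move=> Hp; apply: (Hp (D 1%N)) => // _ [i ->] m.
  by rewrite msuppX inE => /eqP->; rewrite mdeg1.
elim: k g => // k IHk g Hg; apply: (Hg (D k.+1)) => // _ [p [q [/max1 Dp /IHk Dq ->]]].
move=> m /msuppM_le /allpairsP[[m1 m2] /= [/Dp Hm1 /Dq Hm2 ->]].
by rewrite mdegD -add1n leq_add.
Qed.

Lemma ideal_expX (i : 'I_n) (k : nat) :
  ideal_exp (@max_ideal K n) k 'X_[U_(i) *+ k].
Proof.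
elim: k => // k IHk J _; apply; exists 'X_i, 'X_[U_(i) *+ k]; split=> //.
  by move=> J' _; apply; exists i.
by rewrite mulmS mpolyXD.
Qed.

(* If [x_j] does not divide the generator, it divides the cofactor. *)
Lemma strongly_stable_monomials (I : {mpoly K[n]} -> Prop) :
  monomial_ideal I -> strongly_stable I ->
  forall (m : 'X_{1..n}) (i j : 'I_n), (i < j)%N ->
    I 'X_[m + U_(j)] -> I 'X_[m + U_(i)].
Proof.
move=> /mingensP[IG _] ssI m i j lt_ij /IG/mono_genX[g Gg le_g].
have [gj|] := boolP (U_(j) <= g)%MM.
  have /IG Ig := ssI g Gg i j lt_ij gj; apply/IG.
  have -> : (m + U_(i) = (U_(i) + g - U_(j)) + (m + U_(j) - g))%MM.
    apply/mnmP=> l; move/mnm_lepP/(_ l): le_g; move/mnm_lepP/(_ l): gj.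
    by rewrite !(mnmDE, mnmBE); lia.
  exact: mono_genDr.
rewrite lep1mP negbK => /eqP gj0; apply/IG/mono_genX; exists g => //.
apply/mnm_lepP=> l; move/mnm_lepP/(_ l): le_g; rewrite !mnmDE [U_(j)%MM l]mnm1E.
case: eqP => [<- _|_]; first by rewrite gj0.
by rewrite addn0 => le_g; apply: leq_trans le_g (leq_addr _ _).
Qed.

(** Forward, test against the element [x_i0^k] of [m^k]. Backward, each monomial of an element of
    [m^k] has degree at least [k], so its variables can replace the [k] factors [x_i0]. *)
Lemma strongly_stable_colon (I : {mpoly K[n]} -> Prop) (i0 : 'I_n) :
  monomial_ideal I -> strongly_stable I -> (forall i : 'I_n, (i <= i0)%N) ->
  forall (k : nat) f, ideal_colon I (ideal_exp (@max_ideal K n) k) f <->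
    forall m, m \in msupp f -> I 'X_[m + U_(i0) *+ k].
Proof.
move=> monI ssI last_i0 k f.
have stepI := strongly_stable_monomials I monI ssI.
have [IG _] := mingensP monI.
split=> [If m fm|suppI g Hg].
  have /IG/mono_gen_msuppP HI := If _ (ideal_expX i0 k).
  apply/IG; apply: HI; rewrite (perm_mem (msuppMX _ _)).
  by apply/mapP; exists m; rewrite // addmC.
(* Each step trades one [x_i0] for a variable dividing [v] and moves that variable into [w]; at
   [j = 0] what is left of [v] is a harmless cofactor. *)
have swap j : forall w v : 'X_{1..n}, I 'X_[w + U_(i0) *+ j] ->
    (j <= mdeg v)%N -> I 'X_[w + v].
  elim: j => [|j IHj] w v.
    by rewrite mulm0n addm0 => /IG Iw _; apply/IG; apply: mono_genDr.
  move=> Iw lt_jv.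
  have [i vi] : exists i, (U_(i) <= v)%MM.
    apply: NNPP => no_i; move: lt_jv; rewrite mdegE big1 // => i _.
    by apply/eqP/negPn/negP => vi; apply: no_i; exists i; rewrite lep1mP.
  rewrite -(submK vi) [(_ - _ + _)%MM]addmC addmA; apply: IHj.
    rewrite -addmA [(_ + _ *+ j)%MM]addmC addmA.
    have : I 'X_[w + U_(i0) *+ j + U_(i0)] by rewrite -addmA -mulmSr.
    by case: (ltngtP i i0) (last_i0 i) => // [lt_i|/val_inj->] _; first exact: stepI.
  by rewrite -(submK vi) mdegD mdeg1 addn1 in lt_jv.
apply/IG/mono_gen_msuppP => m /msuppM_le /allpairsP[[m1 m2] /= [fm1 gm2 ->]].
by apply/IG/(swap k); [apply: suppI | apply: (ideal_exp_msupp k g)].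
Qed.

End MonomialIdeal.

Theorem theorem1p2 (K : fieldType) (n : nat) (I : {mpoly K[n.+1]} -> Prop)
    (hI : monomial_ideal I) (hss : strongly_stable I) :
  exists s : nat,
    is_sat I s /\
    is_max (fun l : nat =>
              exists2 u : 'X_{1..n.+1},
                mingens I u & (U_(ord_max) *+ l <= u)%MM) s.
Proof.
have mG := mingensP hI; have [IG _] := mG.
have primG := minimal_gens_primitive mG.
set A := (X in is_max X).
(* With all exponents compared, the element below a minimal generator is that generator itself, so
   [B] bounds the exponents of the last variable and the maximum exists. *)
have [B HB] := dickson _ n.+1 (mingens I) (fun m => m ord_max).
have [s maxs] : exists s, is_max A s.
  apply: (is_max_exists A B) => l [u Gu]; rewrite lemMn1 => le_lu.
  have [g [Gg le_gu gB]] := HB u Gu.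
  have Egu : g = u.
    by apply: (proj2 (primG u Gu)) => //; apply/mnm_lepP => i; apply: le_gu.
  by apply: leq_trans le_lu _; rewrite -Egu.
exists s; split=> //.
have colonP := strongly_stable_colon _ _ I ord_max hI hss (@leq_ord n).
split=> [f|k same_k].
  split=> /colonP suppI; apply/colonP => m fm; apply/IG.
    by rewrite mulmSr addmA; apply: mono_genDr; apply/IG; apply: suppI.
  have /IG/mono_genX[g Gg /mnm_lepP le_g] := suppI m fm.
  apply/mono_genX; exists g => //; apply/mnm_lepP => i; have := le_g i.
  (* Only the last exponent depends on the power of the last variable, and there [s] alone already
     bounds that of [g]. *)
  rewrite !mnmDE !mulmnE mnm1E; case: eqP => [<- _|_]; last by rewrite !mul0n.
  have le_gs : (g ord_max <= s)%N.
    have Ag : A (g ord_max) by exists g; rewrite // lemMn1.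
    by case: maxs => [[_ ->]|[/(_ _ Ag)]].
  by rewrite mul1n; apply: leq_trans le_gs (leq_addl _ _).
(* If there are no generators, [s = 0] and minimality is trivial. *)
case: maxs => [[[u Gu le_su] _]|[_ ->] //].
rewrite leqNgt; apply/negP => lt_ks; rewrite lemMn1 in le_su.
have le_u : (U_(ord_max) *+ k.+1 <= u)%MM by rewrite lemMn1 (leq_trans lt_ks).
pose w := (u - U_(ord_max) *+ k.+1)%MM.
have /same_k/colonP Iw : ideal_colon I (ideal_exp (@max_ideal K n.+1) k.+1) 'X_[w].
  apply/colonP => m; rewrite msuppX inE => /eqP->; rewrite submK //.
  by apply/IG; apply: mono_gen_mem.
have /IG/mono_genX[g Gg /mnm_lepP le_g] : I 'X_[w + U_(ord_max) *+ k].
  by apply: Iw; rewrite msuppX inE.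
(* Here [g] divides [u / x_n], hence [u]. Equality then fails at the last exponent, where the
   truncated subtraction is exact because [k < s <= u ord_max]. *)
have Egu : g = u.
  apply: (proj2 (primG u Gu)) => //; apply/mnm_lepP => i; have := le_g i.
  move/mnm_lepP/(_ i): le_u; rewrite mnmDE mnmBE !mulmnE; lia.
have := le_g ord_max; rewrite Egu mnmDE mnmBE !mulmnE mnm1E eqxx; lia.
Qed.
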